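(* Let $\Delta\subset\mathcal M$ be a double coset. Then $\mathcal B_\Delta\subset\mathcal A_\Delta$, and for $\xi\in\mathcal B_\Delta$: (a) there exists $\beta(\xi)\in\mathbb Q$ such that $\langle\xi,K\rangle=\beta(\xi)$ for all right cosets $K\in\Delta/\Gamma$; (b) $\beta(\xi)=-\alpha(\xi)$. Moreover, the map $\beta:\mathcal B_\Delta\to\mathbb Q$ is surjective.
   Context: Let $\Gamma=\mathrm{PSL}_2(\mathbb Z)$, $S=\pm\begin{pmatrix}0&-1\\1&0\end{pmatrix}$, $U=\pm\begin{pmatrix}1&-1\\1&0\end{pmatrix}$, $T=US=\pm\begin{pmatrix}1&1\\0&1\end{pmatrix}$. Let $\mathcal M$ be the set of $2\times2$ integer matrices of positive determinant modulo $\{\pm1\}$, $\mathcal R=\mathbb Q[\mathcal M]$ the $\mathbb Q$-algebra of formal finite linear combinations with multiplication extending matrix multiplication ($1$ = identity). For $\xi=\sum c_MM$ and $\mathcal S\subset\mathcal M$, $\langle\xi,\mathcal S\rangle=\sum_{M\in\mathcal S}c_M$. Put $\pi_S=(1+S)/2$, $\pi_U=(1+U+U^2)/3$, $\mathcal I=\pi_S\mathcal R+\pi_U\mathcal R$, $\mathcal A=\{\xi\in\mathcal R:\xi\pi_S\in\mathcal I,\ \xi\pi_U\in\mathcal I\}$, $\mathcal B=\{\xi\in\mathcal R:\xi\pi_S\in\pi_U\mathcal R,\ \xi\pi_U\in\pi_S\mathcal R\}$. For a double coset $\Delta=\Gamma\delta\Gamma$ let $\mathcal R_\Delta=\mathbb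 Q[\Delta]$, $\mathcal A_\Delta=\mathcal A\cap\mathcal R_\Delta$, $\mathcal B_\Delta=\mathcal B\cap\mathcal R_\Delta$. Let $T_\Delta^\infty=\sum_{M\in\mathcal M^\infty_\Delta}M$ with $\mathcal M_\Delta^\infty$ a set of representatives of $\Gamma\backslash\Delta$ with lower-left entry $0$. For $\xi\in\mathcal A_\Delta$, $\alpha(\xi)\in\mathbb Q$ denotes the unique number with $(1-S)\xi-\alpha(\xi)T_\Delta^\infty(1-S)\in(1-T)\mathcal R_\Delta$ (such a unique number exists for every $\xi\in\mathcal A_\Delta$). *)

(* Defs.v *)
From HB Require Import structures.
From mathcomp Require Import all_boot all_order all_algebra finmap.
From mathcomp.multinomials Require Export monalg.
From mathcomp Require Export boolp classical_sets functions fsbigop.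

Set Implicit Arguments.
Unset Strict Implicit.
Unset Printing Implicit Defensive.

Import Order.TTheory GRing.Theory Num.Theory.
Local Open Scope classical_set_scope.
Local Open Scope ring_scope.
Local Open Scope quotient_scope.

Notation posmx := {A : 'M[int]_2 | 0 < \det A}.

Definition pmeq (A B : posmx) : bool := (val A == val B) || (val A == - val B).

Lemma pmeq_refl : reflexive pmeq.
Proof. by move=> A; rewrite /pmeq eqxx. Qed.

Lemma pmeq_sym : symmetric pmeq.
Proof.
by move=> A B; rewrite /pmeq [val A == val B]eq_sym -eqr_oppLR [_ == val B]eq_sym.
Qed.

Lemma pmeq_trans : transitive pmeq.
Proof.
move=> B A C /orP[]/eqP AB /orP[]/eqP BC; rewrite /pmeq AB BC ?opprK ?eqxx ?orbT //.
Qed.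

Canonical pmeq_equiv := EquivRel pmeq pmeq_refl pmeq_sym pmeq_trans.

Definition matpm := {eq_quot pmeq}.
HB.instance Definition _ := Choice.on matpm.
HB.instance Definition _ := EqQuotient.on matpm.

Lemma posmx1_subproof : 0 < \det (1%:M : 'M[int]_2).
Proof. by rewrite det1. Qed.

Lemma posmxM_subproof (A B : posmx) : 0 < \det (val A *m val B).
Proof. by rewrite det_mulmx mulr_gt0 ?(valP A) ?(valP B). Qed.

Definition posmx1 : posmx := Sub 1%:M posmx1_subproof.
Definition posmxM (A B : posmx) : posmx := Sub (val A *m val B) (posmxM_subproof A B).

(* Locked, like bm below: unification must not compute with representatives. *)
HB.lock Definition cls (A : posmx) : matpm := \pi_matpm A.

Lemma clsP (A B : posmx) : reflect (cls A = cls B) (pmeq A B).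
Proof. by rewrite cls.unlock; apply: (iffP idP) => /eqmodP. Qed.

Lemma cls_surj (m : matpm) : exists A, m = cls A.
Proof. by exists (repr m); rewrite cls.unlock reprK. Qed.

HB.lock Definition matpmM (m n : matpm) : matpm := cls (posmxM (repr m) (repr n)).

Lemma matpmM_cls (A B : posmx) : matpmM (cls A) (cls B) = cls (posmxM A B).
Proof.
rewrite matpmM.unlock; apply/clsP.
have /clsP hA : cls (repr (cls A)) = cls A by rewrite cls.unlock reprK.
have /clsP hB : cls (repr (cls B)) = cls B by rewrite cls.unlock reprK.
move: hA hB; rewrite /pmeq /= => /orP[]/eqP-> /orP[]/eqP->.
- by rewrite eqxx.
- by rewrite mulmxN eqxx orbT.
- by rewrite mulNmx eqxx orbT.
- by rewrite mulNmx mulmxN opprK eqxx.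
Qed.

Lemma matpmMA : associative matpmM.
Proof.
move=> m n p; have [A ->] := cls_surj m; have [B ->] := cls_surj n.
have [C ->] := cls_surj p; rewrite !matpmM_cls.
by congr cls; apply/val_inj; rewrite /= mulmxA.
Qed.

Lemma matpm1M : left_id (cls posmx1) matpmM.
Proof.
move=> m; have [A ->] := cls_surj m; rewrite matpmM_cls.
by congr cls; apply/val_inj; rewrite /= mul1mx.
Qed.

Lemma matpmM1 : right_id (cls posmx1) matpmM.
Proof.
move=> m; have [A ->] := cls_surj m; rewrite matpmM_cls.
by congr cls; apply/val_inj; rewrite /= mulmx1.
Qed.

HB.instance Definition _ := isMonoid.Build matpm matpmMA matpm1M matpmM1.

Definition mx2 (a b c d : int) : 'M[int]_2 :=
  \matrix_(i, j) if i == 0 then if j == 0 then a else b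
                 else if j == 0 then c else d.

Lemma det_mx2 a b c d : \det (mx2 a b c d) = a * d - b * c.
Proof.
rewrite (expand_det_row _ 0) !big_ord_recl big_ord0 /cofactor !det_mx11 !mxE /=.
by rewrite expr0 expr1 mul1r mulN1r addr0 mulrN.
Qed.

Lemma detS_subproof : 0 < \det (mx2 0 (-1) 1 0).
Proof. by rewrite det_mx2. Qed.

Lemma detU_subproof : 0 < \det (mx2 1 (-1) 1 0).
Proof. by rewrite det_mx2. Qed.

Lemma detT_subproof : 0 < \det (mx2 1 1 0 1).
Proof. by rewrite det_mx2. Qed.

Definition mS : matpm := cls (exist _ (mx2 0 (-1) 1 0) detS_subproof).
Definition mU : matpm := cls (exist _ (mx2 1 (-1) 1 0) detU_subproof).
Definition mT : matpm := cls (exist _ (mx2 1 1 0 1) detT_subproof).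

Lemma mT_US : mT = (mU * mS)%g.
Proof.
rewrite [RHS]matpmM_cls; apply/clsP/orP; right; apply/eqP/matrixP=> i j.
rewrite !mxE /= 2!big_ord_recl big_ord0 !mxE /=.
by case: i j => [[|[|]]// ?] [[|[|]]// ?].
Qed.

Definition PSL2Z : set matpm := [set cls A | A in [set A : posmx | \det (val A) = 1]].

Definition lowerleft0 : set matpm :=
  [set cls A | A in [set A : posmx | val A 1 0 = 0]].

(* The ring instance that monalg puts on {malg rat[K]} asks for a monoid K with
   no unit other than 1, so the same convolution product is put on an alias. *)
Definition QM := {malg rat[matpm]}.
HB.instance Definition _ := GRing.Lmodule.on QM.

Definition QM1 : QM := << 1%g >>.
HB.lock Definition QMmul (x y : QM) : QM :=
  \sum_(m <- msupp x) \sum_(n <- msupp y) << x@_m * y@_n *g (m * n)%g >>.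

Lemma QMmulw (d1 d2 : {fset matpm}) (x y : QM) :
  (msupp x `<=` d1)%fset -> (msupp y `<=` d2)%fset ->
  QMmul x y = \sum_(m <- d1) \sum_(n <- d2) << x@_m * y@_n *g (m * n)%g >>.
Proof.
move=> le1 le2; rewrite QMmul.unlock (big_fset_incl _ le1) /=; last first.
  move=> m _ /mcoeff_outdom xm.
  by rewrite big1 // => n _; rewrite xm mul0r monalgU0.
apply/eq_bigr => m _; apply/big_fset_incl => // n _ /mcoeff_outdom ->.
by rewrite mulr0 monalgU0.
Qed.

Lemma QMmulUU a b m n : QMmul << a *g m >> << b *g n >> = << a * b *g (m * n)%g >>.
Proof. by rewrite (QMmulw msuppU_le msuppU_le) !big_seq_fset1 !mcoeffUU. Qed.

Lemma QMmulDl : left_distributive QMmul +%R.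
Proof.
move=> x y z; have le m := fsubset_refl (@msupp matpm rat m).
rewrite (QMmulw (msuppD_le x y) (le z)).
rewrite (QMmulw (fsubsetUl _ (msupp y)) (le z)).
rewrite (QMmulw (fsubsetUr (msupp x) _) (le z)).
rewrite -big_split /=; apply/eq_bigr => m _.
rewrite -big_split /=; apply/eq_bigr => n _.
by rewrite mcoeffD mulrDl monalgUD.
Qed.

Lemma QMmulDr : right_distributive QMmul +%R.
Proof.
move=> z x y; have le m := fsubset_refl (@msupp matpm rat m).
rewrite (QMmulw (le z) (msuppD_le x y)).
rewrite (QMmulw (le z) (fsubsetUl _ (msupp y))).
rewrite (QMmulw (le z) (fsubsetUr (msupp x) _)).
rewrite -big_split /=; apply/eq_bigr => m _.
rewrite -big_split /=; apply/eq_bigr => n _.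
by rewrite mcoeffD mulrDr monalgUD.
Qed.

Lemma QM_ind (P : QM -> Prop) :
  P 0 -> (forall x y, P x -> P y -> P (x + y)) ->
  (forall a m, P << a *g m >>) -> forall x, P x.
Proof.
by move=> P0 PD PU x; rewrite [x]monalgE; elim/big_ind: _ => // m _; exact: PU.
Qed.

Lemma QMmul0l : left_zero 0 QMmul.
Proof. by move=> x; rewrite QMmul.unlock msupp0 big_seq_fset0. Qed.

Lemma QMmul0r : right_zero 0 QMmul.
Proof. by move=> x; rewrite QMmul.unlock big1 // => m _; rewrite msupp0 big_seq_fset0. Qed.

Lemma QMmulA : associative QMmul.
Proof.
have z1 y z : QMmul 0 (QMmul y z) = QMmul (QMmul 0 y) z by rewrite !QMmul0l.
have z2 x z : QMmul x (QMmul 0 z) = QMmul (QMmul x 0) z.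
  by rewrite QMmul0l QMmul0r QMmul0l.
have z3 x y : QMmul x (QMmul y 0) = QMmul (QMmul x y) 0 by rewrite !QMmul0r.
have d1 x x' y z : QMmul x (QMmul y z) = QMmul (QMmul x y) z ->
    QMmul x' (QMmul y z) = QMmul (QMmul x' y) z ->
    QMmul (x + x') (QMmul y z) = QMmul (QMmul (x + x') y) z.
  by move=> h h'; rewrite !QMmulDl h h'.
have d2 x y y' z : QMmul x (QMmul y z) = QMmul (QMmul x y) z ->
    QMmul x (QMmul y' z) = QMmul (QMmul x y') z ->
    QMmul x (QMmul (y + y') z) = QMmul (QMmul x (y + y')) z.
  by move=> h h'; rewrite QMmulDl !QMmulDr QMmulDl h h'.
have d3 x y z z' : QMmul x (QMmul y z) = QMmul (QMmul x y) z ->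
    QMmul x (QMmul y z') = QMmul (QMmul x y) z' ->
    QMmul x (QMmul y (z + z')) = QMmul (QMmul x y) (z + z').
  by move=> h h'; rewrite !QMmulDr h h'.
move=> x y z; elim/QM_ind: x => [|x x' hx hx'|a m].
- exact: z1.
- exact: d1.
elim/QM_ind: y => [|y y' hy hy'|b n].
- exact: z2.
- exact: d2.
elim/QM_ind: z => [|z z' hz hz'|c p].
- exact: z3.
- exact: d3.
apply: etrans (congr1 (QMmul _) (QMmulUU b c n p)) _.
apply: etrans (QMmulUU a (b * c) m (n * p)%g) _.
apply: etrans _ (congr1 (QMmul^~ _) (esym (QMmulUU a b m n))).
apply: etrans _ (esym (QMmulUU (a * b) c (m * n)%g p)).
exact: (f_equal2 mkmalgU (mulgA m n p) (mulrA a b c)).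
Qed.

Lemma QMmul1l : left_id QM1 QMmul.
Proof.
elim/QM_ind => [|x y hx hy|a m]; first exact: QMmul0r.
- by rewrite [LHS]QMmulDr hx hy.
- by rewrite QMmulUU mul1r mul1g.
Qed.

Lemma QMmul1r : right_id QM1 QMmul.
Proof.
elim/QM_ind => [|x y hx hy|a m]; first exact: QMmul0l.
- by rewrite [LHS]QMmulDl hx hy.
- by rewrite QMmulUU mulr1 mulg1.
Qed.

Lemma QM1_neq0 : QM1 != 0.
Proof. by rewrite monalgU_eq0. Qed.

HB.instance Definition _ := GRing.Zmodule_isNzRing.Build QM
  QMmulA QMmul1l QMmul1r QMmulDl QMmulDr QM1_neq0.

Lemma QMscaleUU (a b : rat) m : a *: (<< b *g m >> : QM) = << a * b *g m >>.
Proof. by apply/malgP => n; rewrite mcoeffZ !mcoeffU mulrnAr. Qed.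

Lemma QMscale_mull (a : rat) (x : QM) : a *: x = (<< a *g 1%g >> : QM) * x.
Proof.
elim/QM_ind: x => [|x y hx hy|b m]; first by rewrite scaler0 mulr0.
- by rewrite scalerDr mulrDr hx hy.
- by rewrite [RHS]QMmulUU mul1g QMscaleUU.
Qed.

Lemma QMscale_mulr (a : rat) (x : QM) : a *: x = x * (<< a *g 1%g >> : QM).
Proof.
elim/QM_ind: x => [|x y hx hy|b m]; first by rewrite scaler0 mul0r.
- by rewrite scalerDr mulrDl hx hy.
- by rewrite [RHS]QMmulUU mulg1 QMscaleUU mulrC.
Qed.

Lemma QMscaleAl (a : rat) (x y : QM) : a *: (x * y) = (a *: x) * y.
Proof. by rewrite !QMscale_mull mulrA. Qed.

Lemma QMscaleAr (a : rat) (x y : QM) : a *: (x * y) = x * (a *: y).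
Proof. by rewrite !QMscale_mulr mulrA. Qed.

HB.instance Definition _ := GRing.Lmodule_isLalgebra.Build rat QM QMscaleAl.
HB.instance Definition _ := GRing.Lalgebra_isAlgebra.Build rat QM QMscaleAr.

HB.lock Definition bm (m : matpm) : QM := << m >>.

Lemma bm1 : bm 1%g = 1.
Proof. by rewrite bm.unlock. Qed.

Lemma bmM m n : bm (m * n)%g = bm m * bm n.
Proof. by rewrite bm.unlock [RHS]QMmulUU mulr1. Qed.

Definition pairing (x : QM) (A : set matpm) : rat := \sum_(m \in A) x@_m.

Definition rS : QM := bm mS.
Definition rU : QM := bm mU.
Definition rT : QM := bm mT.

Definition piS : QM := 2%:R^-1 *: (1 + rS).
Definition piU : QM := 3%:R^-1 *: (1 + rU + rU ^+ 2).

Definition rideal (x : QM) : set QM := [set x * y | y in setT].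

Definition idealI : set QM := [set x + y | x in rideal piS & y in rideal piU].

Definition algA : set QM := [set x | idealI (x * piS) /\ idealI (x * piU)].

Definition algB : set QM :=
  [set x | rideal piU (x * piS) /\ rideal piS (x * piU)].

Definition is_double_coset (D : set matpm) : Prop :=
  exists d, D = [set (g * d * h)%g | g in PSL2Z & h in PSL2Z].

Definition right_cosets (D : set matpm) : set (set matpm) :=
  [set [set (m * g)%g | g in PSL2Z] | m in D].

Definition QD (D : set matpm) : set QM := [set x | [set` msupp x] `<=` D].
Definition algA_ (D : set matpm) : set QM := algA `&` QD D.
Definition algB_ (D : set matpm) : set QM := algB `&` QD D.

Definition is_cusp_reps (D : set matpm) (X : {fset matpm}) : Prop :=
  [set` X] `<=` D `&` lowerleft0 /\
  forall m, D m -> exists! r, r \in X /\ exists2 g, PSL2Z g & m = (g * r)%g.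

Definition Tinf (X : {fset matpm}) : QM := \sum_(m <- X) bm m.

(* Definite description: on algA_ D exactly one rational satisfies the
   condition, and it does not depend on the representatives X; elsewhere the
   value is meaningless. *)
Definition alpha (D : set matpm) (X : {fset matpm}) (x : QM) : rat :=
  xget 0 [set a | [set (1 - rT) * y | y in QD D]
                    ((1 - rS) * x - a *: (Tinf X * (1 - rS)))].

(* Main.v *)
Require Import Defs.
From mathcomp Require Import all_boot all_order all_algebra finmap.
From mathcomp Require Import boolp classical_sets functions fsbigop.
From mathcomp Require Import zify ring lra.

(** Write [Z = (1 - S) xi], [NS = 1 + S] and [NU = 1 + U + U^2].  For [xi] in B the element
    [xi NU] is left [S]-invariant and [xi NS] is left [U]-invariant, so that [Z NU = 0] and
    [Z NS = (1 - T^-1) xi NS]; invariance under generators also makes the sums of [xi] over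
    right cosets constant, equal to [beta].

    Let [F m] be the sum of [Z] over the orbit [<T> m].  The two relations become
    [F m + F (m S) = 0] and the three term relation [F m = F (m T) + F (m T')], where [T'] is
    the transpose of [T].  Iterating the latter increases a bottom row with positive entries,
    so finiteness of the support forces [F = 0] off the matrices having a zero in the bottom
    row, and [F (m T) = F m] if the lower left entry of [m] vanishes.

    Summing [F m * m] over the upper triangular [(a b; 0 d)] with [0 <= b < d], resp.
    [- a <= b < 0], gives [Y], resp. [W], with [Z - Y (1 - S) = (1 - T) y] for some [y] and
    [Y (T^-1 - 1) = (1 - T) W].  As [1 - T] is injective and
    [(1 - S) NU = (1 - T^-1) NU], it follows that [y NS = - T^-1 xi NS] and [y NU = W NU].
    Summing both over the coset of an upper triangular [m], which contains exactly one matrix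
    from the range of [W], yields [F m = - beta].

    For surjectivity take [V] in Q[Delta] with sum 1 over each right coset, and put
    [p = piU V piS], [q = piS V piU].  The sums of [q - p piU] over right cosets vanish, and as
    [S] and [U] generate, [q - p piU = y (1 - S) piU] for some [y]; then [p + y (1 - S)] lies
    in B and has [beta = 1]. *)

Set Implicit Arguments.
Unset Strict Implicit.
Unset Printing Implicit Defensive.

Import Order.TTheory GRing.Theory Num.Theory.
Local Open Scope classical_set_scope.
Local Open Scope ring_scope.

(** * Matrices modulo sign *)

(* Equal to [1] when the determinant is not positive. *)
Definition cm (a b c d : int) : matpm :=
  if insub (mx2 a b c d) is Some A then cls A else 1%g.

(** The power [T^n]; writing it as a matrix makes negative exponents available in the monoid
    [matpm]. *)
Definition tz (n : int) : matpm := cm 1 n 0 1.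

Lemma mx2_eta (A : 'M[int]_2) : A = mx2 (A 0 0) (A 0 1) (A 1 0) (A 1 1).
Proof.
apply/matrixP => i j; rewrite mxE.
by case: i j => [[|[|]]// ?] [[|[|]]// ?] /=; congr (A _ _); apply/val_inj.
Qed.

Lemma mx2_inj a b c d a' b' c' d' :
  mx2 a b c d = mx2 a' b' c' d' -> [/\ a = a', b = b', c = c' & d = d'].
Proof.
move=> e; split; [have := congr1 (fun A : 'M_2 => A 0 0) e |
  have := congr1 (fun A : 'M_2 => A 0 1) e | have := congr1 (fun A : 'M_2 => A 1 0) e |
  have := congr1 (fun A : 'M_2 => A 1 1) e]; by rewrite /= !mxE.
Qed.

Lemma mx2N a b c d : - mx2 a b c d = mx2 (- a) (- b) (- c) (- d).
Proof. by rewrite [LHS]mx2_eta !mxE. Qed.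

Lemma mx2M a b c d a' b' c' d' : mx2 a b c d *m mx2 a' b' c' d' =
  mx2 (a * a' + b * c') (a * b' + b * d') (c * a' + d * c') (c * b' + d * d').
Proof.
by rewrite [LHS]mx2_eta !mxE /= !big_ord_recl !big_ord0 !mxE /= !addr0.
Qed.

Lemma cls_cm (A : posmx) a b c d : val A = mx2 a b c d -> cls A = cm a b c d.
Proof. by move=> h; rewrite /cm -h valK. Qed.

Lemma cm_cls a b c d : 0 < a * d - b * c ->
  exists2 A : posmx, val A = mx2 a b c d & cm a b c d = cls A.
Proof.
move=> h; have h' : 0 < \det (mx2 a b c d) by rewrite det_mx2.
by exists (Sub (mx2 a b c d) h' : posmx); rewrite ?SubK // -(@cls_cm (Sub (mx2 a b c d) h')) ?SubK.
Qed.

Lemma cm_surj m : exists a b c d, 0 < a * d - b * c /\ m = cm a b c d.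
Proof.
have [A ->] := cls_surj m; have e := mx2_eta (val A).
exists (val A 0 0), (val A 0 1), (val A 1 0), (val A 1 1); split.
  by have := valP A; rewrite {1}e det_mx2.
exact: cls_cm.
Qed.

Lemma cm_eq a b c d a' b' c' d' :
  0 < a * d - b * c -> 0 < a' * d' - b' * c' -> cm a b c d = cm a' b' c' d' ->
  [/\ a = a', b = b', c = c' & d = d'] \/ [/\ a = - a', b = - b', c = - c' & d = - d'].
Proof.
move=> /cm_cls[A hA ->] /cm_cls[B hB ->] /clsP; rewrite /pmeq hA hB mx2N.
by case/orP => /eqP/mx2_inj; [left|right].
Qed.

Lemma cmN a b c d : 0 < a * d - b * c -> cm (- a) (- b) (- c) (- d) = cm a b c d.
Proof.
move=> h; have [A hA ->] := cm_cls h.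
have [B hB ->] : exists2 B : posmx, val B = mx2 (- a) (- b) (- c) (- d) &
  cm (- a) (- b) (- c) (- d) = cls B by apply: cm_cls; lia.
by apply/clsP; rewrite /pmeq hA hB mx2N eqxx orbT.
Qed.

Lemma cmM a b c d a' b' c' d' : 0 < a * d - b * c -> 0 < a' * d' - b' * c' ->
  (cm a b c d * cm a' b' c' d')%g =
  cm (a * a' + b * c') (a * b' + b * d') (c * a' + d * c') (c * b' + d * d').
Proof.
move=> /cm_cls[A hA ->] /cm_cls[B hB ->].
by rewrite [LHS]matpmM_cls; apply: cls_cm; rewrite /= hA hB mx2M.
Qed.

Lemma cm1 : (1%g : matpm) = cm 1 0 0 1.
Proof. by apply: cls_cm; rewrite /= [LHS]mx2_eta !mxE. Qed.

Lemma mSE : mS = cm 0 (-1) 1 0. Proof. exact: cls_cm. Qed.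
Lemma mUE : mU = cm 1 (-1) 1 0. Proof. exact: cls_cm. Qed.
Lemma mTE : mT = tz 1. Proof. exact: cls_cm. Qed.

Lemma PSL2ZP m : PSL2Z m <-> exists a b c d, a * d - b * c = 1 /\ m = cm a b c d.
Proof.
split=> [[A hA <-]|[a [b [c [d [h ->]]]]]].
  have e := mx2_eta (val A); move: hA; rewrite /= {1}e det_mx2 => hA.
  by do 4 eexists; split; [exact: hA|exact: cls_cm].
have [|A hA ->] := @cm_cls a b c d; first by lia.
by exists A => //=; rewrite hA det_mx2.
Qed.

Lemma PSL2Z_cm a b c d : a * d - b * c = 1 -> PSL2Z (cm a b c d).
Proof. by move=> h; apply/PSL2ZP; exists a, b, c, d. Qed.

Lemma lowerleft0P a b c d : 0 < a * d - b * c -> lowerleft0 (cm a b c d) <-> c = 0.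
Proof.
move=> h; have [A hA e] := cm_cls h; rewrite e; split=> [[B hB]|c0].
  move=> /clsP; rewrite /pmeq hA mx2N (mx2_eta (val B)).
  by case/orP => /eqP/mx2_inj[_ _]; rewrite hB /=; lia.
by exists A; rewrite //= hA mxE.
Qed.

(** The diagonal entries have a positive product, and the free sign makes both positive; successors
    of naturals record this. *)
Lemma lowerleft0_tri m : lowerleft0 m ->
  exists (a d : nat) (b : int), m = cm a.+1 b 0 d.+1.
Proof.
have [a [b [c [d [h ->]]]]] := cm_surj m => /(lowerleft0P h) c0.
rewrite c0 mulr0 subr0 in h *; have [a0|a0|a0] := ltgtP a 0; last by rewrite a0 mul0r in h.
  have d0 : d < 0 by nia.
  exists (absz a).-1, (absz d).-1, (- b); rewrite -cmN ?mulr0 ?subr0 //; congr cm; lia.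
have d0 : 0 < d by nia.
exists (absz a).-1, (absz d).-1, b; congr cm; lia.
Qed.

Lemma tz0 : tz 0 = 1%g. Proof. by rewrite cm1. Qed.

Lemma tzD n k : tz (n + k) = (tz n * tz k)%g.
Proof. by rewrite /tz cmM; [congr cm; ring|lia|lia]. Qed.

Lemma tzM n a b c d : 0 < a * d - b * c ->
  (tz n * cm a b c d)%g = cm (a + n * c) (b + n * d) c d.
Proof. by move=> h; rewrite /tz cmM; [congr cm; ring|lia|lia]. Qed.

Lemma Mtz n a b c d : 0 < a * d - b * c ->
  (cm a b c d * tz n)%g = cm a (b + n * a) c (d + n * c).
Proof. by move=> h; rewrite /tz cmM; [congr cm; ring|lia|lia]. Qed.

Lemma MmS a b c d : 0 < a * d - b * c -> (cm a b c d * mS)%g = cm b (- a) d (- c).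
Proof. by move=> h; rewrite mSE cmM; [congr cm; ring|lia|lia]. Qed.

Lemma PSL2Z_tz n : PSL2Z (tz n). Proof. by apply: PSL2Z_cm; lia. Qed.

Lemma PSL2Z1 : PSL2Z 1%g. Proof. by rewrite -tz0; exact: PSL2Z_tz. Qed.
Lemma PSL2Z_S : PSL2Z mS. Proof. by rewrite mSE; apply: PSL2Z_cm. Qed.
Lemma PSL2Z_U : PSL2Z mU. Proof. by rewrite mUE; apply: PSL2Z_cm. Qed.
Lemma PSL2ZM g h : PSL2Z g -> PSL2Z h -> PSL2Z (g * h)%g.
Proof.
move=> /PSL2ZP[a [b [c [d [e ->]]]]] /PSL2ZP[a' [b' [c' [d' [e' ->]]]]].
rewrite cmM; [|lia|lia]; apply: PSL2Z_cm.
by rewrite -[RHS]mulr1 -{1}e -e'; ring.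
Qed.

Lemma PSL2Z_inv g : PSL2Z g -> exists h, [/\ PSL2Z h, (g * h)%g = 1%g & (h * g)%g = 1%g].
Proof.
move=> /PSL2ZP[a [b [c [d [e ->]]]]]; exists (cm d (- b) (- c) a).
split; first by apply: PSL2Z_cm; lia.
all: by rewrite cmM ?cm1; [congr cm; lia|lia|lia].
Qed.

Lemma mSS : (mS * mS)%g = 1%g.
Proof. by rewrite mSE cmM // cm1 -cmN //; congr cm. Qed.

Lemma mUUU : (mU * mU * mU)%g = 1%g.
Proof. by rewrite mUE !cmM // cm1 -cmN //; congr cm. Qed.

Lemma mSUU : (mS * mU * mU)%g = tz (-1).
Proof. by rewrite mSE mUE !cmM // -cmN //; congr cm. Qed.

Lemma mTtz : (mT * tz (-1))%g = 1%g. Proof. by rewrite mTE -tzD subrr tz0. Qed.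
Lemma tzmT : (tz (-1) * mT)%g = 1%g. Proof. by rewrite mTE -tzD addNr tz0. Qed.

(* Euclid's algorithm on the bottom row. *)
Lemma euclid_ind (P : matpm -> Prop) :
  (forall m, lowerleft0 m -> P m) -> (forall m, P (m * mS)%g -> P m) ->
  (forall m n, P (m * tz n)%g -> P m) -> forall m, P m.
Proof.
move=> P0 PS PT m; have [a [b [c [d [h ->]]]]] := cm_surj m.
have [k] := ubnP `|c|%N; elim: k a b c d h => // k IH a b c d h ck.
have [c0|c0] := eqVneq c 0; first by apply/P0/lowerleft0P.
have := divz_eq d c; set q := divz d c => dE.
have r0 := modz_ge0 d c0; have r1 := ltz_mod d c0.
(* [T^(- q)] reduces [d] modulo [c], and [S] moves the remainder, smaller than [c] in absolute
   value, into the lower left corner. *)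
apply: (PT _ (- q)); rewrite Mtz //; apply: PS; rewrite MmS; last by lia.
apply: IH; [lia|].
have -> : d + - q * c = modz d c by lia.
lia.
Qed.

(** Since [T = U S] and [T^-1 = S U U], the property passes along all translations; Euclid's
    algorithm then leaves only the upper triangular elements of the group, which are
    translations. *)
Lemma PSL2Z_gen (P : matpm -> Prop) :
  P 1%g -> (forall g, P g -> P (g * mS)%g) -> (forall g, P g -> P (g * mU)%g) ->
  forall g, PSL2Z g -> P g.
Proof.
move=> P1 PS PU.
have PT g : P g -> P (g * mT)%g by rewrite mT_US mulgA => /PU/PS.
have PT' g : P g -> P (g * tz (-1))%g by rewrite -mSUU !mulgA => /PS/PU/PU.
have PTn g n : P g -> P (g * tz n)%g.
  move=> Pg; elim/int_rec: n => [|n IH|n IH]; first by rewrite tz0 mulg1.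
    by rewrite -addn1 PoszD tzD mulgA -mTE; exact: PT.
  by rewrite -addn1 PoszD opprD tzD mulgA; exact: PT'.
apply: euclid_ind => [g /lowerleft0_tri[a [d [b ->]]] /PSL2ZP|g IH G|g n IH G].
- case=> [a' [b' [c' [d' [e h]]]]].
  suff -> : cm a.+1 b 0 d.+1 = (1 * tz b)%g by exact: PTn.
  have [] : (a = 0 /\ d = 0)%N by case: (cm_eq _ _ h) => [||[]|[]]; nia.
  by move=> -> ->; rewrite mul1g.
- have := PS _ (IH (PSL2ZM G PSL2Z_S)); by rewrite -mulgA mSS mulg1.
- have := PTn _ (- n) (IH (PSL2ZM G (PSL2Z_tz n))).
  by rewrite -mulgA -tzD subrr tz0 mulg1.
Qed.

Lemma coset_tri m : exists (a d : nat) (b : int) g, PSL2Z g /\ (m * g)%g = cm a.+1 b 0 d.+1.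
Proof.
elim/euclid_ind: m => [m /lowerleft0_tri[a [d [b e]]]|
  m [a [d [b [g [G e]]]]]|m n [a [d [b [g [G e]]]]]]; exists a, d, b.
- by exists 1%g; split; [exact: PSL2Z1|rewrite mulg1].
- by exists (mS * g)%g; split; [exact: PSL2ZM PSL2Z_S G|rewrite mulgA].
- by exists (tz n * g)%g; split; [exact: PSL2ZM (PSL2Z_tz n) G|rewrite mulgA].
Qed.

(** * Finitely supported functions and their sums *)

(** The linear extension of [f]; for [f = ind E] it is [pairing], as a finite sum over the
    support. *)
Definition pr (x : QM) (f : matpm -> rat) : rat := \sum_(m <- msupp x) x@_m * f m.

Definition ind (E : set matpm) (m : matpm) : rat := (m \in E)%:R.

Lemma indT (E : set matpm) m : E m -> ind E m = 1.
Proof. by move=> Em; rewrite /ind mem_set. Qed.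

Lemma indF (E : set matpm) m : ~ E m -> ind E m = 0.
Proof. by move=> Em; rewrite /ind memNset. Qed.

Lemma eq_ind (E E' : set matpm) m m' : (E m <-> E' m') -> ind E m = ind E' m'.
Proof.
move=> h; have [Em|Em] := pselect (E m); first by rewrite !indT //; apply/h.
by rewrite !indF // => /h.
Qed.

Lemma prw (d : {fset matpm}) x f : (msupp x `<=` d)%fset ->
  pr x f = \sum_(m <- d) x@_m * f m.
Proof. by move=> h; apply: big_fset_incl => // m _ /mcoeff_outdom ->; rewrite mul0r. Qed.

Lemma prD x y f : pr (x + y) f = pr x f + pr y f.
Proof.
rewrite (prw _ (msuppD_le x y)) (prw _ (fsubsetUl _ (msupp y))).
rewrite (prw _ (fsubsetUr (msupp x) _)) -big_split.
by apply: eq_bigr => m _; rewrite mcoeffD mulrDl.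
Qed.

Lemma prZ a x f : pr (a *: x) f = a * pr x f.
Proof.
rewrite (prw _ (msuppZ_le a x)) mulr_sumr.
by apply: eq_bigr => m _; rewrite mcoeffZ mulrA.
Qed.

Lemma prN x f : pr (- x) f = - pr x f.
Proof. by rewrite -scaleN1r prZ mulN1r. Qed.

Lemma prB x y f : pr (x - y) f = pr x f - pr y f.
Proof. by rewrite prD prN. Qed.

Lemma pr0 f : pr 0 f = 0.
Proof. by rewrite -(scale0r (0 : QM)) prZ mul0r. Qed.

Lemma pr_sum I (r : seq I) (P : pred I) (F : I -> QM) f :
  pr (\sum_(i <- r | P i) F i) f = \sum_(i <- r | P i) pr (F i) f.
Proof. by elim/big_rec2: _ => [|i y z _ <-]; [exact: pr0|rewrite prD]. Qed.

Lemma mcoeff_bm m n : (bm m)@_n = (m == n)%:R.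
Proof. by rewrite bm.unlock mcoeffU. Qed.

Lemma pr_bm m f : pr (bm m) f = f m.
Proof.
rewrite (@prw [fset m]%fset) ?big_seq_fset1 ?mcoeff_bm ?eqxx ?mul1r //.
by rewrite bm.unlock msuppU_le.
Qed.

Lemma prZr x a f : pr x (fun m => a * f m) = a * pr x f.
Proof. by rewrite mulr_sumr; apply: eq_bigr => m _; rewrite mulrCA. Qed.

Lemma pr_delta x m : pr x (ind [set m]) = x@_m.
Proof.
rewrite (@prw (msupp x `|` [fset m])%fset) ?fsubsetUl // (big_fsetD1 m) /=; last first.
  by rewrite !inE eqxx orbT.
rewrite indT // mulr1 big1_seq ?addr0 // => n /=; rewrite !inE => /andP[/eqP nm _].
by rewrite indF ?mulr0.
Qed.

Lemma QM_decomp (x : QM) : x = \sum_(m <- msupp x) x@_m *: bm m.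
Proof.
by rewrite {1}[x]monalgE; apply: eq_bigr => m _; rewrite bm.unlock QMscaleUU mulr1.
Qed.

Lemma QDP D x : QD D x <-> forall m, x@_m != 0 -> D m.
Proof. by split=> h m hm; apply: h; move: hm; rewrite /= mcoeff_neq0. Qed.

Lemma QD_ind D (P : QM -> Prop) : P 0 -> (forall x y, P x -> P y -> P (x + y)) ->
  (forall a m, D m -> P (a *: bm m)) -> forall x, QD D x -> P x.
Proof.
move=> P0 PD PU x hx; rewrite [x]QM_decomp big_seq.
by elim/big_ind: _ => // m mx; apply: PU; exact: hx.
Qed.

Lemma QMbm_ind (P : QM -> Prop) : P 0 -> (forall x y, P x -> P y -> P (x + y)) ->
  (forall a m, P (a *: bm m)) -> forall x, P x.
Proof. by move=> P0 PD PU x; apply: (@QD_ind setT) => // a m _. Qed.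

Lemma prMl g x f : pr (bm g * x) f = pr x (fun m => f (g * m)%g).
Proof.
elim/QMbm_ind: x => [|x y hx hy|a m].
- by rewrite mulr0 !pr0.
- by rewrite mulrDr !prD hx hy.
- by rewrite -scalerAr -bmM !prZ !pr_bm.
Qed.

Lemma prMr g x f : pr (x * bm g) f = pr x (fun m => f (m * g)%g).
Proof.
elim/QMbm_ind: x => [|x y hx hy|a m].
- by rewrite mul0r !pr0.
- by rewrite mulrDl !prD hx hy.
- by rewrite -scalerAl -bmM !prZ !pr_bm.
Qed.

Lemma eq_pr_in D x f g : QD D x -> (forall m, D m -> f m = g m) -> pr x f = pr x g.
Proof. by move=> hx h; apply: eq_big_seq => m mx; rewrite h //; exact: hx. Qed.

Lemma eq_pr x f g : f =1 g -> pr x f = pr x g.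
Proof. by move=> h; apply: eq_bigr => m _; rewrite h. Qed.

Lemma pairing_pr x E : pairing x E = pr x (ind E).
Proof.
rewrite /pairing fsbig_mkcond (fsbigTE (msupp x)) => [|m /mcoeff_outdom xm].
  by apply: eq_bigr => m _; rewrite /patch /ind; case: ifP; rewrite ?mulr1 ?mulr0.
by rewrite /patch xm if_same.
Qed.

Lemma QD_bm (D : set matpm) m : D m -> QD D (bm m).
Proof.
by move=> Dm; apply/QDP => n; rewrite mcoeff_bm; case: (eqVneq m n) => [<-|] //; rewrite eqxx.
Qed.

Lemma QD0 D : QD D 0.
Proof. by apply/QDP => m; rewrite mcoeff0 eqxx. Qed.

Lemma QDD D x y : QD D x -> QD D y -> QD D (x + y).
Proof.
move=> /QDP hx /QDP hy; apply/QDP => m; rewrite mcoeffD.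
have [->|/hx //] := eqVneq x@_m 0; by rewrite add0r => /hy.
Qed.

Lemma QDZ D a x : QD D x -> QD D (a *: x).
Proof. by move=> /QDP hx; apply/QDP => m; rewrite mcoeffZ mulf_eq0 => /norP[_ /hx]. Qed.

Lemma QDN D x : QD D x -> QD D (- x).
Proof. by move=> h; rewrite -scaleN1r; exact: QDZ. Qed.

Lemma QDB D x y : QD D x -> QD D y -> QD D (x - y).
Proof. by move=> hx hy; apply: QDD => //; exact: QDN. Qed.

Lemma QD_sum D I (r : seq I) (P : pred I) (F : I -> QM) :
  (forall i, P i -> QD D (F i)) -> QD D (\sum_(i <- r | P i) F i).
Proof. by move=> h; elim/big_ind: _ => [|x y|//]; [exact: QD0|exact: QDD]. Qed.

Lemma QDMl (D D' : set matpm) g x : (forall m, D m -> D' (g * m)%g) -> QD D x -> QD D' (bm g * x).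
Proof.
move=> h; elim/(@QD_ind D) => [|y z hy hz|a m Dm].
- by rewrite mulr0; exact: QD0.
- by rewrite mulrDr; exact: QDD.
- by rewrite -scalerAr -bmM; apply: QDZ; apply: QD_bm; exact: h.
Qed.

Lemma QDMr (D D' : set matpm) g x : (forall m, D m -> D' (m * g)%g) -> QD D x -> QD D' (x * bm g).
Proof.
move=> h; elim/(@QD_ind D) => [|y z hy hz|a m Dm].
- by rewrite mul0r; exact: QD0.
- by rewrite mulrDl; exact: QDD.
- by rewrite -scalerAl -bmM; apply: QDZ; apply: QD_bm; exact: h.
Qed.

(* The vanishing of all fibre sums makes the retraction of [x] along [rho] zero. *)
Lemma fibre_sums0 (rho : matpm -> matpm) x :
  (forall p, pr x (ind [set m | rho m = p]) = 0) ->
  x = \sum_(m <- msupp x) x@_m *: (bm m - bm (rho m)).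
Proof.
move=> h; under eq_bigr do rewrite scalerBr.
rewrite sumrB -QM_decomp; set y := (X in _ - X).
suff -> : y = 0 by rewrite subr0.
apply/malgP => p; rewrite mcoeff0 -pr_delta -(h p) pr_sum.
apply: eq_bigr => m _; rewrite prZ pr_bm; congr (_ * _); exact: eq_ind.
Qed.

(** * Orbits of translations and right cosets *)

(** [C m] is the class of [m] under an equivalence relation. As all class sums of [x] vanish,
    subtracting from each [m] a chosen representative of its class does not change [x]. It serves
    for translation orbits and for right cosets. *)
Lemma class_sums0_ind (C : matpm -> set matpm) (D : set matpm) (J : QM -> Prop) x :
  (forall m, C m m) -> (forall m p, C m p -> C m = C p) ->
  J 0 -> (forall y z, J y -> J z -> J (y + z)) -> (forall a y, J y -> J (a *: y)) ->
  (forall m p, D m -> C m p -> J (bm m - bm p)) ->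
  QD D x -> (forall m, pr x (ind (C m)) = 0) -> J x.
Proof.
move=> Cr Ct J0 JD JZ JC Dx hx; pose rho m := xget 1%g (C m).
have Crho m : C m (rho m) by apply: xgetI (Cr m).
rewrite (@fibre_sums0 rho x) => [|p].
  rewrite big_seq; elim/big_ind: _ => // m mx; apply/JZ/JC => //; exact: Dx.
have [[m mp]|np] := pselect (exists m, rho m = p); last first.
  (* Zero is written [0 * 0] so that [prZr] can pull out a factor. *)
  rewrite (@eq_pr _ _ (fun=> 0 * 0)) => [|m]; first by rewrite prZr mul0r.
  by rewrite mul0r indF // => mp; apply: np; exists m.
rewrite -(hx m); apply: eq_pr => n; apply: eq_ind; rewrite /= -mp; split=> [e|/Ct e].
  by rewrite (Ct _ _ (Crho m)) -e -(Ct _ _ (Crho n)).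
by rewrite /rho e.
Qed.

Definition orb (m : matpm) : set matpm := [set p | exists n, p = (tz n * m)%g].
Definition rcos (m : matpm) : set matpm := [set (m * g)%g | g in PSL2Z].
(** The subspace divided out in forming the coinvariants of [T], spelled as in [alpha]. *)
Definition coinvT (D : set matpm) : set QM := [set (1 - rT) * y | y in QD D].

Lemma tzNK n m : (tz (- n) * (tz n * m))%g = m.
Proof. by rewrite mulgA -tzD addNr tz0 mul1g. Qed.

Lemma orb_refl m : orb m m. Proof. by exists 0; rewrite tz0 mul1g. Qed.

Lemma orb_tz n m : orb (tz n * m)%g = orb m.
Proof.
apply/seteqP; split=> p [k ->]; first by exists (k + n); rewrite tzD mulgA.
by exists (k - n); rewrite tzD -mulgA tzNK.
Qed.

Lemma orb_eq m p : orb m p -> orb m = orb p.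
Proof. by case=> n ->; rewrite orb_tz. Qed.

Lemma orb_sym m p : orb m p -> orb p m.
Proof. by move/orb_eq <-; exact: orb_refl. Qed.

Lemma rcos_refl m : rcos m m.
Proof. by exists 1%g; [exact: PSL2Z1|rewrite mulg1]. Qed.

Lemma rcosM m g : PSL2Z g -> rcos (m * g)%g = rcos m.
Proof.
move=> G; apply/seteqP; split=> _ [h H <-].
  by exists (g * h)%g; [exact: PSL2ZM|rewrite mulgA].
have [g' [G' gg' _]] := PSL2Z_inv G.
by exists (g' * h)%g; [exact: PSL2ZM|rewrite mulgA -(mulgA m) gg' mulg1].
Qed.

Lemma rcos_eq m p : rcos m p -> rcos m = rcos p.
Proof. by case=> g G <-; rewrite rcosM. Qed.

Lemma rcos_Mr m p g : PSL2Z g -> rcos m (p * g)%g <-> rcos m p.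
Proof.
move=> G; split=> h; rewrite (rcos_eq h); last by exists g.
by rewrite (rcosM _ G); exact: rcos_refl.
Qed.

Lemma rcos_Ml m p g : rcos m p -> rcos (g * m)%g (g * p)%g.
Proof. by case=> h H <-; exists h; rewrite ?mulgA. Qed.

Lemma coinvT0 D : coinvT D 0.
Proof. by exists 0; [exact: QD0|rewrite mulr0]. Qed.

Lemma coinvTD D x y : coinvT D x -> coinvT D y -> coinvT D (x + y).
Proof. by move=> [x' hx <-] [y' hy <-]; exists (x' + y'); [exact: QDD|rewrite mulrDr]. Qed.

Lemma coinvTZ D a x : coinvT D x -> coinvT D (a *: x).
Proof. by move=> [x' hx <-]; exists (a *: x'); [exact: QDZ|rewrite scalerAr]. Qed.

Lemma coinvT_tz (D : set matpm) n m : (forall k p, D p -> D (tz k * p)%g) -> D m ->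
  coinvT D (bm m - bm (tz n * m)%g).
Proof.
move=> hD Dm; have step k : coinvT D (bm (tz k * m)%g - bm (tz (1 + k) * m)%g).
  exists (bm (tz k * m)%g); first by apply: QD_bm; exact: hD.
  by rewrite mulrBl mul1r -bmM mTE mulgA -tzD.
elim/int_rec: n => [|n IH|n IH]; first by rewrite tz0 mul1g subrr; exact: coinvT0.
  have := coinvTD IH (step n); rewrite addrA subrK.
  by rewrite -PoszD.
have := coinvTD IH (coinvTZ (-1) (step (- n.+1%:Z))).
rewrite scaleN1r opprB.
have -> : 1 - n.+1%:Z = - n%:Z by lia.
by rewrite addrA subrK.
Qed.

Lemma coinvTP (D : set matpm) x : (forall k p, D p -> D (tz k * p)%g) -> QD D x ->
  (forall m, pr x (ind (orb m)) = 0) -> coinvT D x.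
Proof.
move=> hD; apply: class_sums0_ind.
- exact: orb_refl.
- exact: orb_eq.
- exact: coinvT0.
- exact: coinvTD.
- exact: coinvTZ.
- by move=> m p Dm [n ->]; exact: coinvT_tz.
Qed.

(** Translations fix the bottom row; it is nonzero, which rules out the sign [-1] and makes the top
    row determine [n]. *)
Lemma tz_inj m : injective (fun n => (tz n * m)%g).
Proof.
have [a [b [c [d [h ->]]]]] := cm_surj m => n k; rewrite !tzM // => /cm_eq.
case=> [||[e1 e2 _ _]|[_ _ e1 e2]]; [lia|lia| |nia].
have [c0|c0] := eqVneq c 0; last by apply: (mulIf c0); lia.
by have [d0|d0] := eqVneq d 0; [nia|apply: (mulIf d0); lia].
Qed.

(** The coefficients of a [T]-invariant element are constant along translation orbits, which are
    infinite, whereas the support is finite. *)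
Lemma sub1T_inj x : (1 - rT) * x = 0 -> x = 0.
Proof.
move/eqP; rewrite mulrBl mul1r subr_eq0 => /eqP xT.
have shift n m : x@_(tz n%:Z * m)%g = x@_m.
  elim: n m => [|n IH] m; first by rewrite tz0 mul1g.
  rewrite [in LHS]xT -pr_delta prMl -IH -pr_delta; apply: eq_pr => p; apply: eq_ind => /=.
  have -> : tz n.+1%:Z = (mT * tz n%:Z)%g by rewrite mTE -tzD.
  split=> [|->]; last by rewrite mulgA.
  by move/(congr1 (monoid.mul (tz (-1)))); rewrite !mulgA tzmT !mul1g.
apply/malgP => m; rewrite mcoeff0; apply/eqP/negP => /negP xm.
pose s := [seq (tz n%:Z * m)%g | n <- iota 0 (size (msupp x)).+1].
have : (size s <= size (msupp x))%N.
  apply: uniq_leq_size => [|_ /mapP[n _ ->]].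
    by rewrite map_inj_uniq ?iota_uniq // => i j /tz_inj[].
  by rewrite -mcoeff_neq0 shift.
by rewrite size_map size_iota ltnn.
Qed.

Lemma sub1T_injl x y : (1 - rT) * x = (1 - rT) * y -> x = y.
Proof. by move=> h; apply/eqP; rewrite -subr_eq0; apply/eqP/sub1T_inj; rewrite mulrBr h subrr. Qed.

Lemma lowerleft0_tz n m : lowerleft0 (tz n * m)%g <-> lowerleft0 m.
Proof.
have [a [b [c [d [h ->]]]]] := cm_surj m; rewrite tzM // !lowerleft0P //; lia.
Qed.

Local Notation tri a b d := (cm (Posz a.+1) b 0 (Posz d.+1)).

Lemma tri_det (a d : nat) b : 0 < (Posz a.+1) * (Posz d.+1) - b * 0.
Proof. by rewrite mulr0 subr0. Qed.
#[local] Hint Resolve tri_det : core.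

Lemma tri_ll a b d : lowerleft0 (tri a b d).
Proof. exact/lowerleft0P. Qed.

Lemma orb_triP a b d a' b' d' :
  orb (tri a b d) (tri a' b' d') <-> [/\ a' = a, d' = d & exists k, b' = b + k * d.+1%:Z].
Proof.
split=> [[n]|[-> -> [k ->]]]; last by exists k; rewrite tzM // mulr0 addr0.
rewrite tzM // mulr0 addr0 => /cm_eq[|||]; [exact: tri_det|exact: tri_det| |]; case.
  by case=> -> -> _ [->]; split=> //; exists n.
lia.
Qed.

(** A group element taking one upper triangular matrix to another is itself upper triangular with
    diagonal [(1, 1)] or [(-1, -1)], hence a power of [T] up to sign. *)
Lemma rcos_triP a b d a' b' d' :
  rcos (tri a b d) (tri a' b' d') <-> [/\ a' = a, d' = d & exists k, b' = b + k * a.+1%:Z].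
Proof.
split=> [[_ /PSL2ZP[x [y [z [w [e ->]]]]]]|[-> -> [k ->]]]; last first.
  by exists (tz k); [exact: PSL2Z_tz|rewrite Mtz // mulr0 addr0].
rewrite cmM ?e // !mul0r !add0r => /cm_eq[|||].
- have -> : (a.+1%:Z * x + b * z) * (d.+1%:Z * w) - (a.+1%:Z * y + b * w) * (d.+1%:Z * z) =
    a.+1%:Z * d.+1%:Z * (x * w - y * z) by ring.
  by rewrite e mulr1.
- exact: tri_det.
- case=> ax bw dz dw; have z0 : z = 0 by lia.
  subst z; rewrite !mulr0 addr0 subr0 in e ax.
  have w0 : 0 < w by lia.
  have x0 : 0 < x by nia.
  have [x1 w1] : x = 1 /\ w = 1 by nia.
  subst; split; [lia|lia|exists y; lia].
- case=> ax bw dz dw; have z0 : z = 0 by lia.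
  subst z; rewrite !mulr0 addr0 subr0 in e ax.
  have w0 : w < 0 by nia.
  have x0 : x < 0 by nia.
  have [x1 w1] : x = -1 /\ w = -1 by nia.
  subst; split; [lia|lia|exists (- y); lia].
Qed.

(** * Sums over upper triangular matrices *)

(** With [P] the orbit sums of [z], this is [Y]: one matrix from each translation orbit, the upper
    right entry running over residues modulo the lower right one. [N] bounds the diagonal
    entries. *)
Definition boxT (N : nat) (P : matpm -> rat) : QM :=
  \sum_(a < N) \sum_(d < N) \sum_(j < d.+1) P (tri a j%:Z d) *: bm (tri a j%:Z d).

(** The corresponding [W]: residues modulo the upper left entry, hence one matrix from each right
    coset. The negative range makes the shifts in [boxT_boxG] match exactly. *)
Definition boxG (N : nat) (P : matpm -> rat) : QM :=
  \sum_(a < N) \sum_(d < N) \sum_(j < a.+1)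
    P (tri a (j%:Z - a.+1%:Z) d) *: bm (tri a (j%:Z - a.+1%:Z) d).

(** The sum of [r] over the first [n + k] indices can be split after [n] or after [k] terms. *)
Lemma sum_shift (V : zmodType) (r : nat -> V) n k :
  \sum_(j < n) (r j - r (j + k)%N) = \sum_(j < k) (r j - r (j + n)%N).
Proof.
have e p q : \sum_(j < p) r j + \sum_(j < q) r (j + p)%N = \sum_(j < p + q) r j.
  by rewrite big_split_ord; congr (_ + _); apply: eq_bigr => j _ /=; rewrite addnC.
rewrite !sumrB; apply/eqP; rewrite subr_eq addrAC eq_sym subr_eq; apply/eqP.
by rewrite !e addnC.
Qed.

(** For a fixed diagonal, [T] on the left raises the upper right entry by the lower right one, and
    [T^-1] on the right lowers it by the upper left one; [sum_shift] exchanges the two. *)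
Lemma boxT_boxG N P : (forall n m, P (tz n * m)%g = P m) ->
  (forall m n, lowerleft0 m -> P (m * tz n)%g = P m) ->
  boxT N P * (bm (tz (-1)) - 1) = (1 - rT) * boxG N P.
Proof.
move=> hL hR; rewrite mulr_suml mulr_sumr; apply: eq_bigr => a _.
rewrite mulr_suml mulr_sumr; apply: eq_bigr => d _; rewrite mulr_suml mulr_sumr.
pose q b := P (tri a b d) *: bm (tri a b d).
have qT b : rT * q b = q (b + d.+1%:Z).
  have e : tri a (b + d.+1%:Z) d = (mT * tri a b d)%g.
    by rewrite mTE tzM //; congr cm; lia.
  by rewrite /q e -scalerAr -bmM mTE hL.
have qT' b : q b * bm (tz (-1)) = q (b - a.+1%:Z).
  have e : tri a (b - a.+1%:Z) d = (tri a b d * tz (-1))%g.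
    by rewrite Mtz //; congr cm; lia.
  by rewrite /q e -scalerAl -bmM hR //; exact: tri_ll.
rewrite -/q; pose r i := q (i%:Z - a.+1%:Z).
transitivity (\sum_(j < d.+1) (r j - r (j + a.+1)%N)).
  apply: eq_bigr => j _; rewrite mulrBr mulr1 -/(q j%:Z) qT'; congr (_ - q _).
  by rewrite PoszD addrK.
rewrite sum_shift; apply: eq_bigr => j _.
rewrite mulrBl mul1r -/(q (j%:Z - a.+1%:Z)) qT; congr (_ - q _).
by rewrite PoszD addrAC.
Qed.

Lemma QD_box_aux D N (P : matpm -> rat) (L : nat -> nat -> nat) (g : nat -> nat -> nat -> matpm) :
  (forall m, P m != 0 -> D m) ->
  QD D (\sum_(a < N) \sum_(d < N) \sum_(j < L a d) P (g a d j) *: bm (g a d j)).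
Proof.
move=> h; do 3!apply: QD_sum => ? _; set m := g _ _ _.
have [->|/h Dm] := eqVneq (P m) 0; first by rewrite scale0r; exact: QD0.
by apply: QDZ; apply: QD_bm.
Qed.

Lemma QD_boxT D N P : (forall m, P m != 0 -> D m) -> QD D (boxT N P).
Proof. exact: (@QD_box_aux D N P (fun a d => d.+1) (fun a d j => tri a j%:Z d)). Qed.

Lemma QD_boxG D N P : (forall m, P m != 0 -> D m) -> QD D (boxG N P).
Proof.
exact: (@QD_box_aux D N P (fun a d => a.+1) (fun a d j => tri a (j%:Z - a.+1%:Z) d)).
Qed.

Lemma big_only (V : nmodType) n (F : 'I_n -> V) (i : nat) x :
  (forall j : 'I_n, val j != i -> F j = 0) -> (forall j : 'I_n, val j = i -> F j = x) ->
  ((i >= n)%N -> x = 0) -> \sum_(j < n) F j = x.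
Proof.
move=> h0 h1 hn; have [ltin|lein] := ltnP i n; last first.
  rewrite (hn lein) big1 // => j _; apply: h0; apply: contraTneq lein => <-.
  by rewrite -ltnNge ltn_ord.
by rewrite (bigD1 (Ordinal ltin)) //= (h1 (Ordinal ltin)) // big1 ?addr0.
Qed.

(* [s a d j] is the upper right entry of the [j]-th of [L a d] matrices with diagonal
   [(a.+1, d.+1)]; exactly one of them lies in the class [E]. *)
Lemma pr_box N (P : matpm -> rat) (L : nat -> nat -> nat) (s : nat -> nat -> nat -> int)
    (E : set matpm) a b d (j0 : nat) :
  (forall a' j d', E (tri a' (s a' d' j) d') -> a' = a /\ d' = d) ->
  (forall j, (j < L a d)%N -> E (tri a (s a d j) d) <-> j = j0) ->
  (j0 < L a d)%N -> P (tri a (s a d j0) d) = P (tri a b d) ->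
  (P (tri a b d) != 0 -> (a < N)%N /\ (d < N)%N) ->
  pr (\sum_(a' < N) \sum_(d' < N) \sum_(j < L a' d')
     P (tri a' (s a' d' j) d') *: bm (tri a' (s a' d' j) d')) (ind E) = P (tri a b d).
Proof.
move=> h1 h2 j0L hP hN.
have zero a' d' : a' <> a \/ d' <> d ->
    \sum_(j < L a' d') pr (P (tri a' (s a' d' j) d') *: bm (tri a' (s a' d' j) d')) (ind E) = 0.
  by move=> ne; rewrite big1 // => j _; rewrite prZ pr_bm indF ?mulr0 // => /h1; lia.
rewrite pr_sum; apply: (big_only (i := a)) => [a' /eqP ne|a' /= ->|aN].
- by rewrite pr_sum big1 // => d' _; rewrite pr_sum zero //; left.
- rewrite pr_sum; apply: (big_only (i := d)) => [d' /eqP ne|d' /= ->|dN].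
  + by rewrite pr_sum zero //; right.
  + rewrite pr_sum; apply: (big_only (i := j0)) => [j /eqP ne|j /= ->|]; last by lia.
      by rewrite prZ pr_bm indF ?mulr0 // => /(h2 _ (ltn_ord j)).
    by rewrite prZ pr_bm indT ?mulr1 //; exact/h2.
  + by apply/eqP/negPn/negP => /hN; lia.
- by apply/eqP/negPn/negP => /hN; lia.
Qed.

Lemma tri_residue (a : nat) (b : int) : exists (j : nat) (k : int),
  (j < a.+1)%N /\ j%:Z = b + k * a.+1%:Z.
Proof.
exists (absz (modz b a.+1%:Z)), (- divz b a.+1%:Z).
have := modz_ge0 b (d := a.+1%:Z) isT; have := ltz_mod b (d := a.+1%:Z) isT.
have := divz_eq b a.+1%:Z; lia.
Qed.

Lemma residue_uniq (n x y : nat) (t : int) :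
  (x < n.+1)%N -> (y < n.+1)%N -> x%:Z = y%:Z + t * n.+1%:Z -> x = y.
Proof.
move=> xn yn e; have [t0|t0|t0] := ltgtP t 0; last by move: e; rewrite t0 mul0r; lia.
  have : t * n.+1%:Z <= - 1 * n.+1%:Z by apply: ler_wpM2r; lia.
  lia.
have : 1 * n.+1%:Z <= t * n.+1%:Z by apply: ler_wpM2r; lia.
lia.
Qed.

Lemma pr_boxT N P a b d : (forall n m, P (tz n * m)%g = P m) ->
  (P (tri a b d) != 0 -> (a < N)%N /\ (d < N)%N) ->
  pr (boxT N P) (ind (orb (tri a b d))) = P (tri a b d).
Proof.
move=> hL hN; have [j0 [k [j0d ej]]] := tri_residue d b.
apply: (@pr_box N P (fun a d => d.+1) (fun a d j => j%:Z) _ a b d j0) => //.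
- by move=> a' j d' /orb_triP[].
- move=> j jd; split=> [/orb_triP[_ _ [k' ]]|->]; last by apply/orb_triP; split=> //; exists k.
  by move=> e; apply: (@residue_uniq d _ _ (k' - k)) => //; lia.
- have -> : tri a j0%:Z d = (tz k * tri a b d)%g by rewrite tzM //; congr cm; lia.
  exact: hL.
Qed.

Lemma pr_boxG N P a b d : (forall m n, lowerleft0 m -> P (m * tz n)%g = P m) ->
  (P (tri a b d) != 0 -> (a < N)%N /\ (d < N)%N) ->
  pr (boxG N P) (ind (rcos (tri a b d))) = P (tri a b d).
Proof.
move=> hR hN; have [j0 [k [j0d ej]]] := tri_residue a b.
apply: (@pr_box N P (fun a d => a.+1) (fun a d j => j%:Z - a.+1%:Z) _ a b d j0) => //.
- by move=> a' j d' /rcos_triP[].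
- move=> j jd; split=> [/rcos_triP[_ _ [k' e]]|->].
    (* The range of [boxG] starts at [- a.+1], which accounts for one extra multiple of [a.+1] here
       and in [k - 1] below. *)
    by apply: (@residue_uniq a _ _ (k' + 1 - k)) => //; lia.
  by apply/rcos_triP; split=> //; exists (k - 1); lia.
- have -> : tri a (j0%:Z - a.+1%:Z) d = (tri a b d * tz (k - 1))%g.
    by rewrite Mtz //; congr cm; lia.
  by apply: hR; exact: tri_ll.
Qed.

Lemma pr_boxT0 N P m : ~ lowerleft0 m -> pr (boxT N P) (ind (orb m)) = 0.
Proof.
move=> mL; rewrite pr_sum big1 // => a _; rewrite pr_sum big1 // => d _.
rewrite pr_sum big1 // => j _; rewrite prZ pr_bm indF ?mulr0 // => /orb_sym[n e].
by apply: mL; rewrite e lowerleft0_tz; exact: tri_ll.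
Qed.

(** * Sums over right cosets and translation orbits *)

Local Notation NS := (1 + rS).
Local Notation NU := (1 + rU + rU ^+ 2).
Local Notation rV := (bm (tz (-1))).

Lemma rSS : rS * rS = 1. Proof. by rewrite -bmM mSS bm1. Qed.
Lemma rTV : rT * rV = 1. Proof. by rewrite -bmM mTtz bm1. Qed.
Lemma rS_NS : rS * NS = NS. Proof. by rewrite mulrDr mulr1 rSS addrC. Qed.
Lemma rU_NU : rU * NU = NU.
Proof. by rewrite expr2 !mulrDr mulr1 mulrA -!bmM mUUU bm1 addrC addrA. Qed.

Lemma rV_NU : rV * NU = rS * NU.
Proof. by rewrite -mSUU !bmM -!mulrA !rU_NU. Qed.

Lemma piS_NS : 2%:R *: piS = NS.
Proof. by rewrite scalerA mulfV ?scale1r. Qed.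

Lemma piU_NU : 3%:R *: piU = NU.
Proof. by rewrite scalerA mulfV ?scale1r. Qed.

Lemma rS_piS : rS * piS = piS. Proof. by rewrite -scalerAr rS_NS. Qed.
Lemma rU_piU : rU * piU = piU. Proof. by rewrite -scalerAr rU_NU. Qed.

Lemma algB_U x : algB x -> rU * (x * NS) = x * NS.
Proof.
by case=> [[y _ e] _]; rewrite -piS_NS -[x * _]scalerAr -e -scalerAr mulrA rU_piU.
Qed.

Lemma algB_S x : algB x -> rS * (x * NU) = x * NU.
Proof.
by case=> [_ [y _ e]]; rewrite -piU_NU -[x * _]scalerAr -e -scalerAr mulrA rS_piS.
Qed.

Definition rsum (x : QM) (m : matpm) : rat := pr x (ind (rcos m)).

Lemma rsumD x y m : rsum (x + y) m = rsum x m + rsum y m.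
Proof. exact: prD. Qed.

Lemma rsumN x m : rsum (- x) m = - rsum x m.
Proof. exact: prN. Qed.

Lemma rsum_Mr x g m : PSL2Z g -> rsum (x * bm g) m = rsum x m.
Proof. by move=> G; rewrite /rsum prMr; apply: eq_pr => p; apply: eq_ind; exact: rcos_Mr. Qed.

Lemma rsum_Ml x g m : PSL2Z g -> rsum (bm g * x) (g * m)%g = rsum x m.
Proof.
move=> /PSL2Z_inv[h [_ _ hg]]; rewrite /rsum prMl; apply: eq_pr => p; apply: eq_ind.
by split=> [/(rcos_Ml h)|/(rcos_Ml g) //]; rewrite !mulgA hg !mul1g.
Qed.

Lemma rsum_NS x m : rsum (x * NS) m = 2%:R * rsum x m.
Proof.
by rewrite mulrDr mulr1 rsumD (rsum_Mr _ _ PSL2Z_S); ring.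
Qed.

Lemma rsum_NU x m : rsum (x * NU) m = 3%:R * rsum x m.
Proof.
rewrite expr2 !mulrDr mulr1 mulrA !rsumD.
by rewrite !(rsum_Mr _ _ PSL2Z_U); ring.
Qed.

(** Right multiplication by [NU] or [NS] only scales coset sums, by 3 or 2, and the products are
    left invariant under [S], resp. [U]; so both generators preserve the sums of [x]. *)
Lemma algB_rsum x g m : algB x -> PSL2Z g -> rsum x (g * m)%g = rsum x m.
Proof.
move=> Bx G; move: g G m.
apply: (PSL2Z_gen (P := fun g => forall m, rsum x (g * m)%g = rsum x m)) => [m|g IH m|g IH m].
- by rewrite mul1g.
-
  rewrite -mulgA IH; apply: (@mulfI _ 3%:R) => //.
  by rewrite -!rsum_NU -(algB_S Bx) rsum_Ml ?(algB_S Bx) //; exact: PSL2Z_S.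
- rewrite -mulgA IH; apply: (@mulfI _ 2%:R) => //.
  by rewrite -!rsum_NS -(algB_U Bx) rsum_Ml ?(algB_U Bx) //; exact: PSL2Z_U.
Qed.

Definition osum (x : QM) (m : matpm) : rat := pr x (ind (orb m)).

Lemma osumD x y m : osum (x + y) m = osum x m + osum y m.
Proof. exact: prD. Qed.

Lemma osumB x y m : osum (x - y) m = osum x m - osum y m.
Proof. exact: prB. Qed.

Lemma osum_tz x n m : osum x (tz n * m)%g = osum x m.
Proof. by rewrite /osum orb_tz. Qed.

Lemma osum_Ml x n m : osum (bm (tz n) * x) m = osum x m.
Proof.
rewrite /osum prMl; apply: eq_pr => p; apply: eq_ind.
split=> [/orb_sym|/orb_sym]; rewrite ?orb_tz => /orb_sym //.
by move=> h; apply: orb_sym; rewrite orb_tz; exact: orb_sym.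
Qed.

Lemma osum_Mr x g h m : (g * h)%g = 1%g -> (h * g)%g = 1%g ->
  osum (x * bm g) m = osum x (m * h)%g.
Proof.
move=> gh hg; rewrite /osum prMr; apply: eq_pr => p; apply: eq_ind.
split=> [[n e]|[n ->]]; exists n; last by rewrite -!mulgA hg mulg1.
by rewrite mulgA -e -mulgA gh mulg1.
Qed.

Lemma osum_sub1T x m : osum ((1 - rT) * x) m = 0.
Proof. by rewrite mulrBl mul1r osumB /rT mTE osum_Ml subrr. Qed.

Lemma osum_NS x m : osum (x * NS) m = osum x m + osum x (m * mS)%g.
Proof. by rewrite mulrDr mulr1 osumD (osum_Mr _ _ mSS mSS). Qed.

Lemma osum_NU x m : osum (x * NU) m = osum x m + osum x (m * (mU * mU))%g + osum x (m * mU)%g.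
Proof.
rewrite expr2 !mulrDr mulr1 -bmM !osumD.
have UU : (mU * mU * mU)%g = (mU * (mU * mU))%g by rewrite mulgA.
by rewrite (@osum_Mr x mU (mU * mU)%g) ?(@osum_Mr x (mU * mU)%g mU) // -?UU mUUU.
Qed.

Lemma entries_bounded (s : seq matpm) : exists N : nat, forall a b c d,
  0 < a * d - b * c -> cm a b c d \in s -> (`|a| + `|c| + `|d| <= N)%N.
Proof.
elim: s => [|m s [N hN]]; first by exists 0%N.
have [a0 [b0 [c0 [d0 [h0 ->]]]]] := cm_surj m.
exists (N + (`|a0| + `|c0| + `|d0|))%N => a b c d h.
rewrite inE => /orP[/eqP/cm_eq|/hN]; last by lia.
by case=> [||[]|[]]; lia.
Qed.

(** Left translations fix the bottom row, and also the upper left entry if [c = 0], so the finite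
    support bounds these entries. *)
Lemma osum_bounded x : exists N : nat, forall a b c d,
  0 < a * d - b * c -> osum x (cm a b c d) != 0 -> (`|c| + `|d| <= N)%N /\ (c = 0 -> (`|a| <= N)%N).
Proof.
have [N hN] := entries_bounded (msupp x); exists N => a b c d h.
have [[n nx] _|no] := pselect (exists n, cm (a + n * c) (b + n * d) c d \in msupp x); last first.
  rewrite /osum /pr big1_seq ?eqxx // => p /= px; rewrite indF ?mulr0 // => -[n].
  by rewrite tzM // => e; apply: no; exists n; rewrite -e.
have := hN _ _ _ _ _ nx; split; [|move=> c0]; have : 0 < (a + n * c) * d - (b + n * d) * c by lia.
  by move=> /hN/(_ nx); lia.
by move=> /hN/(_ nx); rewrite c0 mulr0 addr0; lia.
Qed.

Lemma osum_supp (D : set matpm) x m : (forall k p, D p -> D (tz k * p)%g) ->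
  QD D x -> osum x m != 0 -> D m.
Proof.
move=> hD Dx /eqP xm; have [//|nD] := pselect (D m); case: xm.
rewrite /osum (eq_pr_in (g := fun=> 0 * 0) Dx); first by rewrite prZr mul0r.
by move=> p Dp; rewrite mul0r indF // => /orb_sym[n e]; apply: nD; rewrite e; exact: hD.
Qed.

(** * Period relations and the value of the orbit sums *)

Section PeriodRelations.
Variables (D : set matpm) (x : QM).
Hypothesis hD : forall g m, PSL2Z g -> D m -> D (g * m)%g /\ D (m * g)%g.
Hypotheses (Bx : algB x) (Dx : QD D x).
Let z : QM := (1 - rS) * x.

Let zNU : z * NU = 0.
Proof. by rewrite -mulrA mulrBl mul1r (algB_S Bx) subrr. Qed.

(** Left [U]-invariance of [x * NS] gives [S x NS = S U U x NS = T^-1 x NS], and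
    [1 - T^-1 = (1 - T) (- T^-1)]. *)
Let zNS : z * NS = (1 - rT) * (- (rV * (x * NS))).
Proof.
rewrite mulrN mulrBl mul1r [rT * _]mulrA rTV mul1r opprB /z -[LHS]mulrA mulrBl mul1r.
congr (_ - _); by rewrite -mSUU !bmM -!mulrA !(algB_U Bx).
Qed.

Let Dz : QD D z.
Proof.
rewrite /z mulrBl mul1r; apply: QDB => //; apply: QDMl Dx => m /(hD PSL2Z_S)[] //.
Qed.

Lemma osumS m : osum z (m * mS)%g = - osum z m.
Proof. by apply/eqP; rewrite -addr_eq0 addrC -osum_NS zNS osum_sub1T. Qed.

(** The relation [z * NU = 0] involves [m], [m U = m T S] and [m U U = m T' S], where [T'] is the
    transpose of [T]; [osumS] removes each [S] at the cost of a sign. *)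
Lemma osum_three a b c d : 0 < a * d - b * c ->
  osum z (cm a b c d) = osum z (cm a (a + b) c (c + d)) + osum z (cm (a + b) b (c + d) d).
Proof.
move=> h; have := osum_NU z (cm a b c d); rewrite zNU {1}/osum pr0.
have -> : (cm a b c d * mU)%g = (cm a (a + b) c (c + d) * mS)%g.
  by rewrite mUE cmM // MmS; [congr cm; lia|lia].
have -> : (cm a b c d * (mU * mU))%g = (cm (a + b) b (c + d) d * mS)%g.
  by rewrite mUE !cmM // MmS; [congr cm; lia|lia].
rewrite !osumS; lra.
Qed.

Lemma osum_pos a b c d : 0 < a * d - b * c -> 0 < c -> 0 < d -> osum z (cm a b c d) = 0.
Proof.
have [N hN] := osum_bounded z.
have [k] := ubnP (N.+1 - (`|c| + `|d|)); elim: k a b c d => // k IH a b c d ck h c0 d0.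
have [//|/hN -/(_ h)[le _]] := eqVneq (osum z (cm a b c d)) 0.
by rewrite osum_three // !IH ?addr0 //; lia.
Qed.

Lemma osum_off a b c d : 0 < a * d - b * c -> c != 0 -> d != 0 -> osum z (cm a b c d) = 0.
Proof.
move=> h c0 d0; wlog c1 : a b c d h c0 d0 / 0 < c.
  move=> W; have [lt|gt] : 0 < c \/ c < 0 by lia.
    exact: W.
  by rewrite -cmN // W // ?oppr_eq0 //; lia.
have [d1|d1] : 0 < d \/ d < 0 by lia.
  exact: osum_pos.
(* Now [c] is positive and [d] negative, so [m S] has the bottom row [(d, - c)], positive after a
   change of sign. *)
have := osumS (cm a b c d); rewrite MmS //.
have -> : osum z (cm b (- a) d (- c)) = 0 by rewrite -cmN; [apply: osum_pos; lia|lia].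
lra.
Qed.

(** In the three term relation for an upper triangular matrix, the term with [T'] has two nonzero
    bottom entries and drops out by [osum_off]. *)
Lemma osum_ll_tz m n : lowerleft0 m -> osum z (m * tz n)%g = osum z m.
Proof.
have step a d b : osum z (tri a (a.+1%:Z + b) d) = osum z (tri a b d).
  rewrite [RHS]osum_three // add0r (@osum_off (a.+1%:Z + b)) ?addr0 //.
  by have := tri_det a d b; lia.
move=> /lowerleft0_tri[a [d [b ->]]].
elim/int_rec: n => [|n <-|n <-]; first by rewrite tz0 mulg1.
  rewrite !Mtz // !mulr0 !addr0.
  have -> : b + n.+1%:Z * a.+1%:Z = a.+1%:Z + (b + n%:Z * a.+1%:Z) by lia.
  exact: step.
rewrite !Mtz // !mulr0 !addr0.
have -> : b + - n%:Z * a.+1%:Z = a.+1%:Z + (b + - n.+1%:Z * a.+1%:Z) by lia.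
by rewrite step.
Qed.

(** All orbit sums of the difference vanish: at [c = 0] by the choice of [y], at [d = 0] by the same
    at [m S] together with [osumS], elsewhere by [osum_off]. Applied to [Y] and to a multiple of
    [Tinf X]. *)
Lemma coinvT_cusp y : QD D y ->
  (forall m, lowerleft0 m -> osum y m = osum z m) ->
  (forall m, ~ lowerleft0 m -> osum y m = 0) -> coinvT D (z - y * (1 - rS)).
Proof.
move=> Dy y1 y0; apply: coinvTP.
- by move=> k p /(hD (PSL2Z_tz k))[].
- apply: QDB => //; rewrite mulrBr mulr1; apply: QDB => //.
  by apply: QDMr Dy => m /(hD PSL2Z_S)[].
move=> m; have [a [b [c [d [h ->]]]]] := cm_surj m.
rewrite -/(osum _ _) osumB mulrBr mulr1 osumB (osum_Mr _ _ mSS mSS).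
have h' : 0 < b * - c - - a * d by lia.
have eS := osumS (cm a b c d); rewrite MmS // in eS *.
have [c0|/eqP c0] := eqVneq c 0.
  rewrite y1; last exact/lowerleft0P.
  rewrite y0 ?subr0 ?subrr // => /(lowerleft0P h') d0.
  by rewrite c0 d0 in h; lia.
rewrite (y0 (cm a b c d)); last by move/(lowerleft0P h).
have [d0|/eqP d0] := eqVneq d 0.
  by rewrite y1 ?eS; [lra|exact/lowerleft0P].
rewrite y0; last by move/(lowerleft0P h').
by rewrite osum_off ?subrr //; apply/eqP.
Qed.

Lemma osum_rsum m : lowerleft0 m -> osum z m = - rsum x m.
Proof.
have [N hN] := osum_bounded z.
have hR n k : lowerleft0 n -> osum z (n * tz k)%g = osum z n by exact: osum_ll_tz.
have hL k n : osum z (tz k * n)%g = osum z n by exact: osum_tz.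
have bd a b d : osum z (tri a b d) != 0 -> (a < N)%N /\ (d < N)%N.
  by move=> /hN -/(_ (tri_det _ _ _))[]; lia.
have [y _ ey] : coinvT D (z - boxT N (osum z) * (1 - rS)).
  apply: coinvT_cusp => [|n /lowerleft0_tri[a [d [b ->]]]|n]; last exact: pr_boxT0.
    by apply: QD_boxT => n; apply: osum_supp Dz => k p /(hD (PSL2Z_tz k))[].
  by apply: pr_boxT => //; exact: bd.
have yNS : y * NS = - (rV * (x * NS)).
  apply: sub1T_injl; rewrite -zNS mulrA ey mulrBl -(mulrA (boxT _ _)) [(1 - rS) * NS]mulrBl.
  by rewrite mul1r rS_NS subrr mulr0 subr0.
(* As [z * NU = 0] and [(1 - S) NU = (1 - T^-1) NU], the product [(1 - T) y NU] equals
   [Y (T^-1 - 1) NU], to which [boxT_boxG] applies. *)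
have yNU : y * NU = boxG N (osum z) * NU.
  apply: sub1T_injl; rewrite !mulrA ey -boxT_boxG // mulrBl zNU sub0r -!(mulrA (boxT _ _)) -mulrN.
  by congr (_ * _); rewrite !mulrBl rV_NU opprB.
move=> /lowerleft0_tri[a [d [b ->]]]; set m0 := tri a b d.
have e1 : rsum y m0 = osum z m0.
  apply: (@mulfI _ 3%:R) => //; rewrite -rsum_NU yNU rsum_NU; congr (_ * _).
  by apply: pr_boxG => //; exact: bd.
have e2 : rsum y m0 = - rsum x m0.
  apply: (@mulfI _ 2%:R) => //; rewrite -rsum_NS yNS rsumN mulrN.
  (* Writing [m0] as [T^-1 (T m0)] cancels the left factor [T^-1]; the remaining [T] is absorbed by
     [algB_rsum]. *)
  rewrite -{1}[m0](tzNK 1) rsum_Ml; last exact: PSL2Z_tz.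
  by rewrite rsum_NS algB_rsum //; exact: PSL2Z_tz.
by rewrite -e1.
Qed.

End PeriodRelations.

(** * Double cosets *)

Lemma rsumZ a x m : rsum (a *: x) m = a * rsum x m.
Proof. exact: prZ. Qed.

Lemma rsumB x y m : rsum (x - y) m = rsum x m - rsum y m.
Proof. exact: prB. Qed.

Lemma rsum_piS x m : rsum (x * piS) m = rsum x m.
Proof. by apply: (@mulfI _ 2%:R) => //; rewrite -rsumZ scalerAr piS_NS rsum_NS. Qed.

Lemma rsum_piU x m : rsum (x * piU) m = rsum x m.
Proof. by apply: (@mulfI _ 3%:R) => //; rewrite -rsumZ scalerAr piU_NU rsum_NU. Qed.

Lemma piSS : piS * piS = piS.
Proof.
rewrite {1}/piS -scalerAl mulrDl mul1r rS_piS -{1 2}[piS]scale1r -scalerDl scalerA.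
by rewrite (_ : _ * _ = 1) // scale1r.
Qed.

Lemma piUU : piU * piU = piU.
Proof.
rewrite {1}/piU -scalerAl !mulrDl mul1r expr2 -mulrA !rU_piU.
rewrite -{1 2 3}[piU]scale1r -!scalerDl scalerA.
by rewrite (_ : _ * _ = 1) // scale1r.
Qed.

Lemma algBZ a x : algB x -> algB (a *: x).
Proof.
by case=> [[y _ ey] [w _ ew]]; split; [exists (a *: y)|exists (a *: w)] => //;
  rewrite -[LHS]scalerAr -[RHS]scalerAl ?ey ?ew.
Qed.

Lemma algB_algA : algB `<=` algA.
Proof.
move=> x [xS xU]; split.
  by exists 0; [exists 0 => //; rewrite mulr0|exists (x * piS); rewrite ?add0r].
by exists (x * piU) => //; exists 0; [exists 0 => //; rewrite mulr0|rewrite addr0].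
Qed.

(** The lower left entry of [g] must vanish, so [g] is a translation up to sign. Thus cusp
    representatives meet each upper triangular translation orbit in [D] exactly once. *)
Lemma ll_orb g r : PSL2Z g -> lowerleft0 r -> lowerleft0 (g * r)%g -> orb (g * r)%g r.
Proof.
move=> /PSL2ZP[x [y [z [w [e ->]]]]] /lowerleft0_tri[a [d [b ->]]].
have dt : 0 < (x * a.+1%:Z + y * 0) * (z * b + w * d.+1%:Z) -
    (x * b + y * d.+1%:Z) * (z * a.+1%:Z + w * 0).
  rewrite (_ : _ - _ = (x * w - y * z) * (a.+1%:Z * d.+1%:Z)); last by ring.
  by rewrite e mul1r.
rewrite cmM //; last by rewrite e.
move=> /(lowerleft0P dt) z0; have {}z0 : z = 0 by lia.
subst z; rewrite mulr0 subr0 in e.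
have [[x1 w1]|[x1 w1]] : (x = 1 /\ w = 1) \/ (x = - 1 /\ w = - 1).
  have [x0|x0|x0] := ltgtP x 0; [right|left|by rewrite x0 mul0r in e].
    have w0 : w < 0 by nia.
    nia.
  have w0 : 0 < w by nia.
  nia.
  subst; exists (- y); rewrite tzM; last by lia.
  congr cm; lia.
subst; exists y; rewrite -[X in _ = (_ * X)%g]cmN; last by lia.
rewrite tzM; last by lia.
congr cm; lia.
Qed.

Section DoubleCoset.
Variables (D : set matpm) (d : matpm).
Hypothesis eD : D = [set (g * d * h)%g | g in PSL2Z & h in PSL2Z].

Lemma double_coset_stable g m : PSL2Z g -> D m -> D (g * m)%g /\ D (m * g)%g.
Proof.
rewrite eD => G [a A [b B <-]]; split.
  by exists (g * a)%g; [exact: PSL2ZM|exists b => //; rewrite !mulgA].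
by exists a => //; exists (b * g)%g; [exact: PSL2ZM|rewrite !mulgA].
Qed.
Let hD := double_coset_stable.

Lemma double_coset_center : D d.
Proof.
rewrite eD; exists 1%g; first exact: PSL2Z1.
by exists 1%g; [exact: PSL2Z1|rewrite mul1g mulg1].
Qed.

Lemma double_coset_tz k p : D p -> D (tz k * p)%g.
Proof. by move=> /(hD (PSL2Z_tz k))[]. Qed.

Lemma rsum_const x m : algB x -> D m -> rsum x m = rsum x d.
Proof.
rewrite eD => Bx [g G [h H <-]].
by rewrite {1}/rsum rcosM // -/(rsum _ _) algB_rsum.
Qed.

Lemma osum_Tinf X m : is_cusp_reps D X -> D m -> lowerleft0 m -> osum (Tinf X) m = 1.
Proof.
move=> [XD hX] Dm mL; have [r [[rX [g G mr]] ru]] := hX _ Dm.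
have rL : lowerleft0 r by have [] := XD r rX.
rewrite /osum pr_sum (big_fsetD1 r) //= pr_bm indT; last first.
  by rewrite mr; apply: ll_orb; rewrite -?mr.
rewrite big1_seq ?addr0 // => s /=; rewrite !inE => /andP[/eqP sr sX].
rewrite pr_bm indF // => /orb_sym[n e]; apply: sr; apply/esym/ru; split=> //.
by exists (tz n) => //; exact: PSL2Z_tz.
Qed.

Lemma osum_Tinf0 X m : is_cusp_reps D X -> ~ lowerleft0 m -> osum (Tinf X) m = 0.
Proof.
move=> [XD _] mL; rewrite /osum pr_sum big1_seq // => s /= sX.
rewrite pr_bm indF // => /orb_sym[n e]; apply: mL.
by rewrite e lowerleft0_tz; have [] := XD s sX.
Qed.

Lemma QD_Tinf X : is_cusp_reps D X -> QD D (Tinf X).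
Proof.
move=> [XD _]; rewrite /Tinf big_seq; apply: QD_sum => s sX; apply: QD_bm.
by have [] := XD s sX.
Qed.

Lemma double_coset_cusp : exists2 m, D m & lowerleft0 m.
Proof.
have [a [e [b [g [G h]]]]] := coset_tri d.
by exists (d * g)%g; [have [] := hD G double_coset_center|rewrite h; exact: tri_ll].
Qed.

Lemma coinvT_alpha X x : is_cusp_reps D X -> algB x -> QD D x ->
  coinvT D ((1 - rS) * x - (- rsum x d) *: (Tinf X * (1 - rS))).
Proof.
move=> hX Bx Dx; rewrite scalerAl; apply: coinvT_cusp => // [|m mL|m mL].
- by apply: QDZ; exact: QD_Tinf.
- have [Dm|nD] := pselect (D m).
    by rewrite (osum_rsum hD) // rsum_const // {1}/osum prZ -/(osum _ _) osum_Tinf ?mulr1.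
  (* Outside [D] the required equality holds because both sides are zero. *)
  have zero w : QD D w -> osum w m = 0.
    by move=> Dw; apply/eqP/negP => /negP/(osum_supp double_coset_tz Dw).
  rewrite !zero //; last by apply: QDZ; exact: QD_Tinf.
  rewrite mulrBl mul1r; apply: QDB => //; apply: QDMl Dx => p /(hD PSL2Z_S)[] //.
- by rewrite {1}/osum prZ -/(osum _ _) osum_Tinf0 ?mulr0.
Qed.

(** For uniqueness, the difference of two admissible values times [Tinf X * (1 - S)] lies in the
    image of [1 - T], where orbit sums vanish. At an upper triangular [m] in [D] the orbit sum of
    that product is 1, since [m S] is not upper triangular. *)
Lemma alpha_rsum X x : is_cusp_reps D X -> algB x -> QD D x -> alpha D X x = - rsum x d.
Proof.
move=> hX Bx Dx; apply: xget_unique; first exact: coinvT_alpha.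
move=> a [y Dy ey]; have [w Dw ew] := coinvT_alpha hX Bx Dx.
have [m Dm mL] := double_coset_cusp.
have mSL : ~ lowerleft0 (m * mS)%g.
  have [a' [b' [c' [d' [h me]]]]] := cm_surj m; rewrite me in mL *.
  move/(lowerleft0P h): mL => c0; rewrite MmS // lowerleft0P; last by lia.
  by move=> d0; rewrite c0 d0 in h; lia.
have := osum_sub1T (y - w) m; rewrite mulrBr ey ew opprB addrC addrA subrK -scalerBl.
rewrite {1}/osum prZ -/(osum _ _) mulrBr mulr1 osumB (osum_Mr _ _ mSS mSS).
rewrite osum_Tinf // osum_Tinf0 // subr0 mulr1; lra.
Qed.

(** * Construction of an element with [beta] equal to 1 *)

Lemma tri_bounded : exists N : nat, forall a b e, D (tri a b e) -> (a < N)%N /\ (e < N)%N.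
Proof.
have [a0 [b0 [c0 [d0 [h0 ed]]]]] := cm_surj d.
(* The bound is the determinant of [d]: it is constant on [D], hence equal to the product of the
   diagonal entries. *)
exists (absz (a0 * d0 - b0 * c0)%R) => a b e; rewrite eD ed.
case=> _ /PSL2ZP[x [y [z [w [xw ->]]]]] [_ /PSL2ZP[x' [y' [z' [w' [xw' ->]]]]]].
rewrite cmM ?xw // => eq1.
have dt : forall p q r s : int, (x * a0 + y * c0) = p -> (x * b0 + y * d0) = q ->
    (z * a0 + w * c0) = r -> (z * b0 + w * d0) = s -> p * s - q * r = a0 * d0 - b0 * c0.
  move=> p q r s <- <- <- <-.
  by rewrite -[RHS]mul1r -xw; ring.
move: eq1 dt.
set p := x * a0 + _; set q := x * b0 + _; set r := z * a0 + _; set s := z * b0 + _.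
move=> eq1 /(_ p q r s erefl erefl erefl erefl) dt.
rewrite cmM ?dt ?xw' // in eq1.
have dt' : (p * x' + q * z') * (r * y' + s * w') - (p * y' + q * w') * (r * x' + s * z') =
    a0 * d0 - b0 * c0 by rewrite -dt -[RHS]mulr1 -xw'; ring.
have dt2 : a.+1%:Z * e.+1%:Z = a0 * d0 - b0 * c0.
  have := h0; rewrite -dt' => q0.
  by case: (cm_eq q0 (tri_det a e b) eq1) => -[-> -> -> ->]; ring.
by rewrite -dt2 -PoszM absz_nat; split; [exact: leq_pmulr|exact: leq_pmull].
Qed.

(** Every right coset contains an upper triangular matrix, so [boxG] with weight 1 on [D] picks one
    element of each. *)
Lemma unit_rsum : exists2 V, QD D V & forall m, D m -> rsum V m = 1.
Proof.
have [N hN] := tri_bounded; exists (boxG N (ind D)) => [|m Dm].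
  apply: QD_boxG => m; have [//|nD] := pselect (D m); by rewrite indF ?eqxx.
have [a [e [b [g [G h]]]]] := coset_tri m.
have Dt : D (tri a b e) by rewrite -h; have [] := hD G Dm.
rewrite /rsum -(rcosM m G) h pr_boxG ?indT // => [n k _|_]; last exact: hN Dt.
apply: eq_ind; split=> [Dn|]; last by move=> /(hD (PSL2Z_tz k))[].
have [] := hD (PSL2Z_tz (- k)) Dn; by rewrite -mulgA -tzD subrr tz0 mulg1.
Qed.

Lemma QD_piS x : QD D x -> QD D (piS * x) /\ QD D (x * piS).
Proof.
move=> Dx; rewrite /piS -scalerAl -scalerAr mulrDl mulrDr mul1r mulr1.
split; apply: QDZ; apply: QDD => //; [apply: QDMl Dx|apply: QDMr Dx] => m /(hD PSL2Z_S)[] //.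
Qed.

Lemma QD_piU x : QD D x -> QD D (piU * x) /\ QD D (x * piU).
Proof.
have l y : QD D y -> QD D (rU * y) by apply: QDMl => m /(hD PSL2Z_U)[].
have r y : QD D y -> QD D (y * rU) by apply: QDMr => m /(hD PSL2Z_U)[].
move=> Dx; split.
  rewrite /piU -scalerAl expr2 !mulrDl mul1r -mulrA; apply: QDZ.
  by do 2?apply: QDD; auto.
rewrite /piU -scalerAr expr2 !mulrDr mulr1 mulrA; apply: QDZ.
by do 2?apply: QDD; auto.
Qed.

Lemma rsum1_Ml x g : PSL2Z g -> (forall m, D m -> rsum x m = 1) ->
  forall m, D m -> rsum (bm g * x) m = 1.
Proof.
move=> G hx m Dm; have [h [H gh hg]] := PSL2Z_inv G.
by rewrite -[m]mul1g -gh -mulgA rsum_Ml // hx //; have [] := hD H Dm.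
Qed.

Lemma rsum1_piS x : (forall m, D m -> rsum x m = 1) -> forall m, D m -> rsum (piS * x) m = 1.
Proof.
move=> hx m Dm; rewrite /piS -scalerAl rsumZ mulrDl mul1r rsumD hx //.
by rewrite (rsum1_Ml PSL2Z_S).
Qed.

Lemma rsum1_piU x : (forall m, D m -> rsum x m = 1) -> forall m, D m -> rsum (piU * x) m = 1.
Proof.
move=> hx m Dm; rewrite /piU -scalerAl rsumZ expr2 !mulrDl mul1r -mulrA !rsumD hx //.
have h1 := rsum1_Ml PSL2Z_U hx.
by rewrite (rsum1_Ml PSL2Z_U h1) // h1.
Qed.

(** It suffices to treat [m - m g], with [g] a word in [S] and [U]. Appending [S] adds
    [m g (1 - S)], and appending [U] changes nothing after multiplication by [piU]. *)
Lemma rsum0_piU x : QD D x -> (forall m, D m -> rsum x m = 0) ->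
  exists2 y, QD D y & x * piU = y * (1 - rS) * piU.
Proof.
move=> Dx hx; pose J w := exists2 y, QD D y & w * piU = y * (1 - rS) * piU.
apply: (@class_sums0_ind rcos D J) => //.
- exact: rcos_refl.
- exact: rcos_eq.
- by exists 0; [exact: QD0|rewrite !mul0r].
- move=> u v [y Dy ey] [w Dw ew]; exists (y + w); first exact: QDD.
  by rewrite !mulrDl ey ew.
- move=> a u [y Dy ey]; exists (a *: y); first exact: QDZ.
  by rewrite -!scalerAl ey.
(* The induction carries [PSL2Z g] along to keep [m * g] in [D]. *)
- move=> m _ Dm [g G <-]; suff [] : PSL2Z g /\ J (bm m - bm (m * g)%g) by [].
  move: g G; apply: PSL2Z_gen => [|g [G [y Dy ey]]|g [G [y Dy ey]]].
  + split; [exact: PSL2Z1|rewrite mulg1 subrr].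
    by exists 0; [exact: QD0|rewrite !mul0r].
  + split; [exact: PSL2ZM PSL2Z_S|exists (y + bm (m * g)%g)].
      by apply: QDD => //; apply: QD_bm; have [] := hD G Dm.
    rewrite !mulrDl -ey -!mulrDl; congr (_ * _).
    by rewrite mulrBr mulr1 -bmM mulgA addrA subrK.
  + split; [exact: PSL2ZM PSL2Z_U|exists y => //].
    by rewrite -ey mulgA [bm (_ * mU)%g]bmM !mulrBl -mulrA rU_piU.
- move=> m; have [Dm|nD] := pselect (D m); first exact: hx.
  rewrite (eq_pr_in (g := fun=> 0 * 0) Dx); first by rewrite prZr mul0r.
  move=> p Dp; rewrite mul0r indF // => -[g G e]; apply: nD.
  have [h [H gh _]] := PSL2Z_inv G; have [_] := hD H Dp.
  by rewrite -e -mulgA gh mulg1.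
Qed.

(** Right multiplication by [piS] kills [y (1 - S)] and fixes [p], which starts with [piU]; by [piU]
    it gives [p piU + (q - p piU) piU = q], which starts with [piS]. The coset sums of [y (1 - S)]
    vanish, so those of [p] are kept. *)
Lemma algB_unit : exists2 x, algB x /\ QD D x & rsum x d = 1.
Proof.
have [V DV V1] := unit_rsum.
pose p := piU * (V * piS); pose q := piS * (V * piU).
have Dp : QD D p by apply: (proj1 (QD_piU _)); exact: (proj2 (QD_piS DV)).
have Dq : QD D q by apply: (proj1 (QD_piS _)); exact: (proj2 (QD_piU DV)).
have p1 m : D m -> rsum p m = 1 by apply: rsum1_piU => n Dn; rewrite rsum_piS V1.
have q1 m : D m -> rsum q m = 1 by apply: rsum1_piS => n Dn; rewrite rsum_piU V1.
have [||y Dy ey] := @rsum0_piU (q - p * piU).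
- by apply: QDB => //; exact: (proj2 (QD_piU Dp)).
- by move=> m Dm; rewrite rsumB rsum_piU p1 // q1 // subrr.
exists (p + y * (1 - rS)); last first.
  rewrite rsumD mulrBr mulr1 rsumB (rsum_Mr _ _ PSL2Z_S) subrr addr0 p1 //.
  exact: double_coset_center.
split; last first.
  apply: QDD => //; rewrite mulrBr mulr1; apply: QDB => //.
  by apply: QDMr Dy => m /(hD PSL2Z_S)[].
split; [exists (V * piS) => //|exists (V * piU) => //].
  rewrite mulrDl -[p * piS]mulrA -[V * piS * _]mulrA piSS -/p.
  by rewrite -(mulrA y) mulrBl mul1r rS_piS subrr mulr0 addr0.
rewrite mulrDl -ey mulrBl -(mulrA p) piUU addrC subrK.
by rewrite -[q * piU]mulrA -[V * piU * _]mulrA piUU.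
Qed.

End DoubleCoset.

Theorem theorem3 (Delta : set matpm) (hDelta : is_double_coset Delta) :
  algB_ Delta `<=` algA_ Delta /\
  exists beta : QM -> rat,
    [/\ forall xi, algB_ Delta xi ->
          forall K, right_cosets Delta K -> pairing xi K = beta xi,
        forall xi, algB_ Delta xi ->
          forall X, is_cusp_reps Delta X -> beta xi = - alpha Delta X xi
      & set_surj (algB_ Delta) setT beta].
Proof.
have [d eD] := hDelta; split=> [xi [/algB_algA Axi Dxi] //|].
exists (fun xi => rsum xi d); split=> [xi [Bxi Dxi] _ [m Dm <-]|xi [Bxi Dxi] X hX|c _].
- by rewrite pairing_pr -/(rcos m) -/(rsum _ _) (rsum_const eD).
- by rewrite (alpha_rsum eD hX) // opprK.
- have [x [Bx Dx] x1] := algB_unit eD; exists (c *: x).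
    by split; [exact: algBZ|exact: QDZ].
  by rewrite rsumZ x1 mulr1.
Qed.
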